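(* Let $a_1,a_2,a_3,\dots$ be an infinite sequence of positive integers with $a_i\geq 2$ for all $i\geq 2$, and let \[ D_{\{a_n\}}:=\Big\{\prod_{i=1}^k a_i \;\Big|\; k\in\mathbb{Z}^+\Big\}. \] Then $D_{\{a_n\}}$ is $2$-accessible if and only if the sequence $\{a_n\}$ contains arbitrarily long strings of consecutive $2$'s (that is, for every positive integer $m$ there is an index $j$ with $a_j=a_{j+1}=\dots=a_{j+m-1}=2$).
   Context: For a set $D$ of positive integers, a $D$-diffsequence of length $k$ is a sequence of positive integers $b_1<b_2<\dots<b_k$ such that $b_i-b_{i-1}\in D$ for $i=2,3,\dots,k$. A set $D$ of positive integers is called $r$-accessible if every $r$-coloring of the positive integers contains arbitrarily long monochromatic $D$-diffsequences (that is, for every coloring with $r$ colors and every $k$ there is a monochromatic $D$-diffsequence of length at least $k$). *)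

(* Defs.v *)
From mathcomp Require Import all_boot.

Set Implicit Arguments.
Unset Strict Implicit.
Unset Printing Implicit Defensive.

(* Positive integers are the nonzero elements of nat, and a set of positive
   integers is a predicate D : nat -> Prop. *)

(* The terms are listed in b, so the length of the diffsequence is size b.
   Since b is strictly increasing, the truncated subtraction is the true
   difference; it is positive, so D 0 is irrelevant. *)
Definition diffsequence (D : nat -> Prop) (b : seq nat) : Prop :=
  [/\ forall x, x \in b -> 0 < x,
      sorted ltn b
    & forall i, i.+1 < size b -> D (nth 0 b i.+1 - nth 0 b i)].

Definition monochromatic (r : nat) (c : nat -> 'I_r) (b : seq nat) : Prop :=
  exists j : 'I_r, forall x, x \in b -> c x = j.

(* The value c 0 is irrelevant: the terms of a diffsequence are positive. *)
Definition accessible (r : nat) (D : nat -> Prop) : Prop :=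
  forall (c : nat -> 'I_r) (k : nat),
    exists b : seq nat,
      [/\ diffsequence D b, k <= size b & monochromatic c b].

(* The sequence is indexed from 1; a 0 is irrelevant. *)
Definition partial_products (a : nat -> nat) : nat -> Prop :=
  fun d => exists2 k, 0 < k & d = \prod_(1 <= i < k.+1) a i.

(* Main.v *)
(** Write P_k = a_1 ... a_k.

    If a_(j+1) = ... = a_(j+k) = 2, then d, 2d, ..., 2^k d all belong to D for
    d = P_j.  Either every x has a successor x + 2^i d of its own color, and
    these can be followed forever, or some x has none, and then
    x + d, x + 2d, x + 4d, ... is monochromatic in the other color.

    Conversely, color x by the parity of floor(2 alpha x), where
    alpha = sum_k j_k / P_k with j_k = floor((a_k - 1) / 2).  Modulo 1,
    alpha P_k is the tail sum_(i > k) j_i / (a_(k+1) ... a_i), which is at most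
    1/2, and is bounded below by a positive constant when the runs of 2's are
    bounded.  So adding an element of D rotates the circle forward by an angle
    between some delta > 0 and 1/2, and a path that stays in one half-circle has
    bounded length.  The real number alpha is replaced by its partial sums
    N_n / P_n: the integers floor(2 x N_n / P_n) are nondecreasing in n and
    bounded, hence eventually constant. *)
Require Import Defs.
From mathcomp Require Import all_boot.
From mathcomp Require Import boolp.
From mathcomp Require Import zify.

Set Implicit Arguments.
Unset Strict Implicit.
Unset Printing Implicit Defensive.

(** * Long runs of 2's give accessibility *)

Lemma diffsequence1 (D : nat -> Prop) (x : nat) :
  0 < x -> diffsequence D [:: x].
Proof. by move=> x_gt0; split=> // y; rewrite inE => /eqP->. Qed.

Lemma diffsequence_cons (D : nat -> Prop) (x y : nat) (b : seq nat) :
  0 < x -> x < y -> D (y - x) -> diffsequence D (y :: b) ->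
  diffsequence D [:: x, y & b].
Proof.
move=> x_gt0 lt_xy Dyx [b_gt0 b_sorted b_diff]; split.
- by move=> z; rewrite inE => /predU1P[->|/b_gt0].
- by rewrite /= lt_xy.
- by case=> [|i] //= /b_diff.
Qed.

Lemma greedy_diffsequence (T : eqType) (D : nat -> Prop) (c : nat -> T) :
  (forall x, 0 < x -> exists d, [/\ 0 < d, D d & c (x + d) = c x]) ->
  forall n x, 0 < x -> exists b,
    [/\ diffsequence D (x :: b), size b = n &
        forall y, y \in x :: b -> c y = c x].
Proof.
move=> succ; elim=> [|n IHn] x x_gt0.
  exists [::]; split=> //; first exact: diffsequence1.
  by move=> y; rewrite inE => /eqP->.
have [d [d_gt0 Dd cd]] := succ x x_gt0.
have [b [Db sb cb]] : exists b, [/\ diffsequence D (x + d :: b), size b = n &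
    forall y, y \in x + d :: b -> c y = c (x + d)] by apply: IHn; lia.
exists (x + d :: b); split; last 1 first.
- by move=> y; rewrite inE => /predU1P[->//|/cb->].
- by apply: diffsequence_cons => //; [lia | rewrite addKn].
- by rewrite /= sb.
Qed.

Lemma doubling_diffsequence (D : nat -> Prop) (x d k : nat) :
  0 < d -> (forall i, i < k -> D (d * 2 ^ i)) ->
  diffsequence D (mkseq (fun i => x + d * 2 ^ i) k).
Proof.
move=> d_gt0 Dd; split.
- by move=> y /mapP[i _ ->]; have := expn_gt0 2 i; nia.
- apply/(sortedP 0) => i; rewrite size_mkseq => lt_ik.
  rewrite !nth_mkseq //; last by lia.
  by have := expn_gt0 2 i; rewrite expnS; nia.
- move=> i; rewrite size_mkseq => lt_ik.
  rewrite !nth_mkseq //; last by lia.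
  have -> : x + d * 2 ^ i.+1 - (x + d * 2 ^ i) = d * 2 ^ i by rewrite expnS; nia.
  by apply: Dd; lia.
Qed.

Lemma ord2_eq_of_neq (i j l : 'I_2) : i != l -> j != l -> i = j.
Proof.
rewrite -!val_eqE => /= ni nj; apply/val_inj => /=.
by have := ltn_ord i; have := ltn_ord j; have := ltn_ord l; lia.
Qed.

Lemma accessible2_doubling (D : nat -> Prop) :
  (forall k, exists2 d, 0 < d & forall i, i < k -> D (d * 2 ^ i)) ->
  accessible 2 D.
Proof.
move=> HD c k; have [d d_gt0 Dd] := HD k.
have [[x nx]|nox] :=
    pselect (exists x, forall i, i < k -> c (x + d * 2 ^ i) != c x).
  exists (mkseq (fun i => x + d * 2 ^ i) k); split.
  - exact: doubling_diffsequence.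
  - by rewrite size_mkseq.
  - exists (if c x == ord0 then ord_max else ord0) => y /mapP[i].
    rewrite mem_iota add0n => /andP[_ lt_ik] ->.
    apply: (@ord2_eq_of_neq _ _ (c x)); first exact: nx.
    by have [->|] := eqVneq (c x) ord0; rewrite // eq_sym.
have succ x : 0 < x -> exists e, [/\ 0 < e, D e & c (x + e) = c x].
  move=> _; apply: contrapT => nex; apply: nox; exists x => i lt_ik.
  apply/eqP => ce; apply: nex; exists (d * 2 ^ i).
  by split; [rewrite muln_gt0 d_gt0 expn_gt0 | exact: Dd |].
have [b [Db sb cb]] := greedy_diffsequence succ k (ltn0Sn 0).
by exists (1 :: b); split=> //=; [lia | exists (c 1)].
Qed.

(** * Partial products and partial sums of the series for alpha *)

Definition pprod (a : nat -> nat) (n : nat) := \prod_(1 <= i < n.+1) a i.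

Definition tail (a : nat -> nat) (k i : nat) := a (k + i).

(* pnum a n / pprod a n is the n-th partial sum of the series for alpha. *)
Fixpoint pnum (a : nat -> nat) (n : nat) :=
  if n is n'.+1 then a n * pnum a n' + (a n).-1./2 else 0.

Lemma pprod0 (a : nat -> nat) : pprod a 0 = 1.
Proof. by rewrite /pprod big_geq. Qed.

Lemma pprodS (a : nat -> nat) (n : nat) : pprod a n.+1 = pprod a n * a n.+1.
Proof. by rewrite /pprod big_nat_recr. Qed.

Lemma pprodD (a : nat -> nat) (k n : nat) :
  pprod a (k + n) = pprod a k * pprod (tail a k) n.
Proof.
elim: n => [|n IHn]; first by rewrite addn0 pprod0 muln1.
by rewrite addnS !pprodS IHn mulnA /tail addnS.
Qed.

(** Divided by [pprod a (k + n)], this splits a partial sum of alpha into its first [k] terms and a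
    tail sum scaled by [1 / pprod a k]. *)
Lemma pnumD (a : nat -> nat) (k n : nat) :
  pnum a (k + n) = pnum a k * pprod (tail a k) n + pnum (tail a k) n.
Proof.
elim: n => [|n IHn]; first by rewrite addn0 pprod0 muln1 addn0.
rewrite addnS /= pprodS IHn /tail addnS; lia.
Qed.

Lemma pprod_gt0 (a : nat -> nat) (n : nat) :
  (forall i, 1 <= i -> 0 < a i) -> 0 < pprod a n.
Proof.
move=> a_pos; elim: n => [|n IHn]; first by rewrite pprod0.
by rewrite pprodS muln_gt0 IHn a_pos.
Qed.

Lemma pprod_run2 (a : nat -> nat) (n : nat) :
  (forall i, 1 <= i <= n -> a i = 2) -> pprod a n = 2 ^ n.
Proof.
elim: n => [|n IHn] a2; first by rewrite pprod0.
by rewrite pprodS expnSr a2 ?IHn // => [i ?|]; [apply: a2 |]; lia.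
Qed.

Lemma pnum_lt (a : nat -> nat) (n : nat) :
  (forall i, 1 <= i -> 0 < a i) -> 2 * pnum a n < pprod a n.
Proof.
move=> a_pos; elim: n => [|n IHn]; first by rewrite pprod0.
by rewrite pprodS /=; have := a_pos n.+1 isT; nia.
Qed.

(** The first term other than 2 already contributes enough, since the product before it is a power
    of 2 below [2 ^ m]; later terms never decrease the ratio [pnum a n / pprod a n]. *)
Lemma pprod_le_pnum (a : nat -> nat) (m n : nat) :
  (forall i, 1 <= i -> 2 <= a i) -> (exists2 i, 1 <= i <= m & a i != 2) ->
  m <= n -> pprod a n <= 2 ^ m * (2 * pnum a n).
Proof.
move=> a_ge2 [i0 /andP[i0_ge1 i0_le] ai0].
have start l : (forall i, 1 <= i <= l -> a i = 2) \/
               pprod a l <= 2 ^ l * (2 * pnum a l).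
  elim: l => [|l [a2|IHl]]; first by left; lia.
    have [al|al] := eqVneq (a l.+1) 2.
      left=> i /andP[i_ge1]; rewrite leq_eqVlt => /predU1P[->//|lt_il].
      by apply: a2; lia.
    right; rewrite pprodS (pprod_run2 a2) /= expnS.
    (* Here [a l.+1] is at least 3; equality occurs at 4. *)
    have : a l.+1 <= 4 * (a l.+1).-1./2 by have := a_ge2 l.+1 isT; lia.
    by have := expn_gt0 2 l; nia.
  right; rewrite pprodS /= expnS.
  have := leq_mul IHl (leqnn (a l.+1)); nia.
move=> /subnKC <-; elim: (n - m) => [|l IHl].
  rewrite addn0; case: (start m) => // a2.
  by rewrite a2 ?i0_ge1 ?eqxx in ai0.
rewrite addnS pprodS /=.
have := leq_mul IHl (leqnn (a (m + l).+1)); nia.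
Qed.

(** * Limits of integer sequences *)

Definition eventually (P : nat -> Prop) := exists n0, forall n, n0 <= n -> P n.

Lemma eventually_and (P Q : nat -> Prop) :
  eventually P -> eventually Q -> eventually (fun n => P n /\ Q n).
Proof.
move=> [p Hp] [q Hq]; exists (maxn p q) => n; rewrite geq_max => /andP[? ?].
by split; [exact: Hp | exact: Hq].
Qed.

Lemma eventually_imp (P Q : nat -> Prop) :
  (forall n, P n -> Q n) -> eventually P -> eventually Q.
Proof. by move=> PQ [p Hp]; exists p => n /Hp/PQ. Qed.

(** Every strict increase uses up part of the room [B - f n0], on which the induction runs. *)
Lemma eventually_constant (f : nat -> nat) (B : nat) :
  (forall n, f n <= f n.+1) -> (forall n, f n <= B) ->
  exists v, eventually (fun n => f n = v).
Proof.
move=> f_incr f_le.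
have f_mono : {homo f : m n / m <= n} by apply: homo_leq => // ? ? ?; exact: leq_trans.
suff: forall e n0, B - f n0 <= e -> exists v, eventually (fun n => f n = v).
  by move/(_ (B - f 0) 0); apply.
elim=> [|e IHe] n0 le_e.
  by exists B, n0 => n /f_mono; have := f_le n; lia.
have [[n /andP[_ lt_f]]|nex] := pselect (exists n, (n0 <= n) && (f n0 < f n)).
  by apply: (IHe n); lia.
exists (f n0), n0 => n le_n; apply/eqP; apply: contra_notT nex => ne.
by exists n; have := f_mono _ _ le_n; lia.
Qed.

(** * The rotation coloring *)

Section RotationColoring.

Variable a : nat -> nat.
Hypothesis a_pos : forall i, 1 <= i -> 0 < a i.

(* The position of 2 alpha x on a circle of circumference 2 pprod a n. *)
Definition angle (n x : nat) := (2 * pnum a n * x) %% (2 * pprod a n).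

Definition upper_half (n x : nat) := pprod a n <= angle n x.

Definition rotation_coloring (x : nat) : 'I_2 :=
  if `[< eventually (fun n => upper_half n x) >] then ord_max else ord0.

(** Half the circumference is [pprod a n], so the quotient counts half-turns. Unlike the angle, it
    is monotone in [n]. *)
Lemma upper_half_odd (n x : nat) :
  upper_half n x = odd ((2 * pnum a n * x) %/ pprod a n).
Proof.
have P_gt0 := pprod_gt0 n a_pos; rewrite /upper_half /angle.
set P := pprod a n in P_gt0 *; set y := 2 * pnum a n * x.
have := divn_eq y (2 * P); have := ltn_pmod y (d := 2 * P).
move: (y %/ _) (y %% _) => q r; rewrite muln_gt0 P_gt0 => /(_ isT) lt_r ->.
rewrite mulnCA mulnA divnMDl // oddD oddM /=.
have [le_P|lt_P] := leqP P r.
  by rewrite -(subnKC le_P) divnDl // divnn P_gt0 divn_small //; lia.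
by rewrite divn_small.
Qed.

Lemma upper_half_stable (x : nat) :
  exists v, eventually (fun n => upper_half n x = v).
Proof.
have [||v Hv] :=
    @eventually_constant (fun n => (2 * pnum a n * x) %/ pprod a n) x.
- move=> n; have a_gt0 := a_pos (ltn0Sn n).
  rewrite pprodS -(divnMr a_gt0); apply: leq_div2r => /=; nia.
- move=> n; have P_gt0 := pprod_gt0 n a_pos.
  rewrite -ltnS ltn_divLR //; have := pnum_lt n a_pos; nia.
by exists (odd v); apply: eventually_imp Hv => n <-; exact: upper_half_odd.
Qed.

Lemma rotation_coloring_stable (x : nat) :
  eventually (fun n => upper_half n x = (rotation_coloring x == ord_max)).
Proof.
rewrite /rotation_coloring; case: asboolP => [|nev].
  by apply: eventually_imp => n ->.
have [[] Hv] := upper_half_stable x; first by case: nev.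
by apply: eventually_imp Hv => n ->.
Qed.

(** By [pnumD], the contribution of [pnum a k] to the rotation is a whole number of turns; only the
    tail sum remains. *)
Lemma angle_rotate (k l x : nat) :
  angle (k + l) (x + pprod a k) =
  (angle (k + l) x + 2 * (pprod a k * pnum (tail a k) l)) %% (2 * pprod a (k + l)).
Proof.
rewrite /angle modnDml mulnDr pprodD pnumD.
set P := pprod a k; set N := pnum a k; set R := pprod _ l; set T := pnum _ l.
set z := 2 * _ * x.
have -> : z + 2 * (N * R + T) * P = N * (2 * (P * R)) + (z + 2 * (P * T)) by nia.
by rewrite modnMDl.
Qed.

(* Wrapping around the circle would change the half, because the rotation is by
   less than half a turn. *)
Lemma angle_step (m k x : nat) :
  (forall i, 2 <= i -> 2 <= a i) ->
  (forall j, 1 <= j -> exists2 i, i < m & a (j + i) != 2) -> 0 < k ->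
  rotation_coloring x = rotation_coloring (x + pprod a k) ->
  eventually (fun n =>
    2 ^ m * angle n x + pprod a n <= 2 ^ m * angle n (x + pprod a k)).
Proof.
move=> a_ge2 no_run k_gt0 eq_c.
(* The tail after index [k] must have at least [m] terms, so that it reaches a term other than 2. *)
have large : eventually (fun n => k + m <= n) by exists (k + m).
apply: eventually_imp (eventually_and large (eventually_and
  (rotation_coloring_stable x) (rotation_coloring_stable (x + pprod a k)))).
move=> n [le_n [ux uy]]; have {uy ux} : upper_half n x = upper_half n (x + pprod a k).
  by rewrite ux uy eq_c.
have -> : n = k + (n - k) by lia.
set l := n - k; rewrite /upper_half angle_rotate.
have tail_lt : 2 * pnum (tail a k) l < pprod (tail a k) l.
  by apply: pnum_lt => i i_ge1; apply: a_pos; lia.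
have tail_ge : pprod (tail a k) l <= 2 ^ m * (2 * pnum (tail a k) l).
  apply: pprod_le_pnum; last by lia.
    by move=> i i_ge1; apply: a_ge2; lia.
  have [i lt_im ai] := no_run k.+1 isT.
  by exists i.+1; rewrite ?/tail ?addnS; [lia | rewrite -addSn].
have P_gt0 := pprod_gt0 k a_pos.
have lt_angle : angle (k + l) x < 2 * pprod a (k + l).
  by rewrite ltn_pmod // muln_gt0 pprod_gt0.
move: (angle _ x) lt_angle => q; rewrite pprodD.
move: (pprod a k) (pprod _ l) (pnum _ l) P_gt0 tail_lt tail_ge => P R T.
move=> P_gt0 tail_lt tail_ge lt_q.
have : 2 * (P * T) < P * R by nia.
have : P * R <= 2 ^ m * (2 * (P * T)) by nia.
move: (2 * (P * T)) (P * R) lt_q => s Q lt_q le_Q lt_s.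
have [lt_qs|le_qs] := ltnP (q + s) (2 * Q).
  by rewrite modn_small // => _; rewrite mulnDr leq_add2l.
rewrite -(subnKC le_qs) modnDl modn_small; last by lia.
have -> : Q <= q by lia.
by have -> : (Q <= q + s - 2 * Q) = false by lia.
Qed.

(** Each step advances the angle by at least a fraction [1 / 2 ^ m] of a half-turn, without wrapping
    around, so [2 ^ m] steps would leave the half-circle. *)
Lemma rotation_coloring_bounded (m : nat) (b : seq nat) :
  (forall i, 2 <= i -> 2 <= a i) ->
  (forall j, 1 <= j -> exists2 i, i < m & a (j + i) != 2) ->
  diffsequence (partial_products a) b -> monochromatic rotation_coloring b ->
  size b <= 2 ^ m.
Proof.
move=> a_ge2 no_run [_ b_sorted b_diff] [col b_col]; rewrite leqNgt; apply/negP => lt_b.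
have advance i : i < size b -> eventually (fun n =>
    2 ^ m * angle n (nth 0 b 0) + i * pprod a n <= 2 ^ m * angle n (nth 0 b i)).
  elim: i => [|i IHi] lt_i; first by exists 0 => n _; rewrite addn0.
  have [k k_gt0 dk] := b_diff i lt_i.
  have lt_nth : nth 0 b i < nth 0 b i.+1 by move/(sortedP 0): b_sorted; exact.
  have step_eq : nth 0 b i.+1 = nth 0 b i + pprod a k by rewrite /pprod -dk; lia.
  have eq_c : rotation_coloring (nth 0 b i) =
              rotation_coloring (nth 0 b i + pprod a k).
    by rewrite -step_eq !b_col // mem_nth // ltnW.
  have := eventually_and (IHi (ltnW lt_i)) (angle_step a_ge2 no_run k_gt0 eq_c).
  by apply: eventually_imp => n []; rewrite step_eq mulSn; lia.
have [n0] := eventually_and (advance _ lt_b) (eventually_and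
  (rotation_coloring_stable (nth 0 b 0)) (rotation_coloring_stable (nth 0 b (2 ^ m)))).
move=> /(_ n0 (leqnn _)) [adv [u0 uL]].
have : upper_half n0 (nth 0 b 0) = upper_half n0 (nth 0 b (2 ^ m)).
  by rewrite u0 uL !b_col // mem_nth //; exact: leq_ltn_trans lt_b.
have P_gt0 := pprod_gt0 n0 a_pos.
have lt_angle : angle n0 (nth 0 b (2 ^ m)) < 2 * pprod a n0.
  by rewrite ltn_pmod // muln_gt0 P_gt0.
move: adv; rewrite -mulnDr leq_pmul2l ?expn_gt0 // /upper_half => adv.
(* The last point is in the upper half, hence so is the first, and a further half-turn exceeds the
   circumference. *)
have -> : pprod a n0 <= angle n0 (nth 0 b (2 ^ m)) by apply: leq_trans adv; exact: leq_addl.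
by move=> le_P; have := leq_trans (leq_add le_P (leqnn _)) adv; rewrite addnn -mul2n leqNgt lt_angle.
Qed.

End RotationColoring.

Theorem theorem1p3 (a : nat -> nat)
    (a_pos : forall i, 1 <= i -> 0 < a i)
    (a_ge2 : forall i, 2 <= i -> 2 <= a i) :
  accessible 2 (partial_products a) <->
  (forall m, 0 < m ->
     exists2 j, 1 <= j & forall i, i < m -> a (j + i) = 2).
Proof.
split=> [acc m m_gt0|runs].
  apply: contrapT => no_run.
  have [b [Db size_b mono_b]] := acc (rotation_coloring a) (2 ^ m).+1.
  have := rotation_coloring_bounded a_pos (m := m) a_ge2 _ Db mono_b.
  rewrite leqNgt size_b => absurd_bound.
  suff no_run2 : forall j, 1 <= j -> exists2 i, i < m & a (j + i) != 2.
    by have := absurd_bound no_run2.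
  move=> j j_ge1; apply: contrapT => run; apply: no_run; exists j => // i lt_im.
  by apply/eqP; apply: contra_notT run => ?; exists i.
(* The length [k.+1] is positive even for [k = 0], as [runs] requires. *)
apply: accessible2_doubling => k; have [j j_ge1 run] := runs k.+1 isT.
exists (pprod a j) => [|i lt_ik]; first exact: pprod_gt0.
exists (j + i); first by lia.
rewrite -/(pprod a (j + i)) pprodD (pprod_run2 (n := i)) // => l ?.
by rewrite /tail run //; lia.
Qed.
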